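(* Let $F_2$ be the free group of rank two and let $\rho$ be a unitary representation of $F_2$ on a uniformly convex Banach space $E\neq 0$. Then $\dim \widetilde{QC}(F_2;\rho)=\infty$.
   Context: Banach spaces are over $\mathbb{R}$ or $\mathbb{C}$, with norm $|\cdot|$; dimensions are over the corresponding scalar field. $E$ is uniformly convex if for every $\epsilon>0$ there is $\delta>0$ such that $x,y\in E$, $|x|\le 1$, $|y|\le 1$, $|x-y|\ge\epsilon$ implies $|\frac{x+y}{2}|\le 1-\delta$. For a group $G$ and a normed vector space $E$, a unitary representation of $G$ on $E$ is a homomorphism $\rho:G\to O(E)$, where $O(E)$ is the group of norm-preserving linear isomorphisms $E\to E$; write $gx=\rho(g)x$. A cocycle is a function $F:G\to E$ with $F(gg')=F(g)+gF(g')$ for all $g,g'\in G$. A quasi-cocycle is a function $F:G\to E$ with $\Delta(F):=\sup_{g,g'\in G}|F(gg')-F(g)-gF(g')|<\infty$. $QC(G;\rho)$ denotes the vector space of all quasi-cocycles, and $\widetilde{QC}(G;\rho)$ denotes the quotient of $QC(G;\rho)$ by the subspace generated by all bounded functions $G\to E$ and all cocycles. *)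

(* Defs.v *)
From HB Require Import structures.
From mathcomp Require Import all_boot all_order all_algebra.
From mathcomp Require Import ring_quotient.
From mathcomp Require Import all_classical all_reals all_analysis.
From mathcomp Require Import complex.

Set Implicit Arguments.
Unset Strict Implicit.
Unset Printing Implicit Defensive.

Import Order.TTheory GRing.Theory Num.Theory.
Import numFieldNormedType.Exports.

Local Open Scope ring_scope.
Local Open Scope quotient_scope.

(* The free group on a set X, as the group of reduced words. The letter       *)
(* (x, false) stands for the generator x and (x, true) for its inverse.       *)
Section FreeGroup.
Variable X : choiceType.

Definition letter := (X * bool)%type.

Definition linv (a : letter) : letter := (a.1, ~~ a.2).

Definition reduced (w : seq letter) : bool :=
  sorted [rel a b | b != linv a] w.

Record free_group := FreeWord { fg_word :> seq letter; _ : reduced fg_word }.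

HB.instance Definition _ := [isSub for fg_word].
HB.instance Definition _ := [Choice of free_group by <:].

Definition push (a : letter) (w : seq letter) : seq letter :=
  if w is b :: w' then (if b == linv a then w' else a :: w) else [:: a].

Definition wmul (u v : seq letter) : seq letter := foldr push v u.

Definition winv (w : seq letter) : seq letter := rev (map linv w).

Lemma linvK : involutive linv.
Proof. by case=> x b; rewrite /linv /= negbK. Qed.

Lemma push_reduced a w : reduced w -> reduced (push a w).
Proof.
case: w => [|b w] //= bw; case: ifPn => [_|ba]; first exact: path_sorted bw.
by rewrite /reduced /= ba.
Qed.

Lemma pushK a w : reduced w -> push (linv a) (push a w) = w.
Proof.
case: w => [|b w] /=; first by rewrite linvK eqxx.
case: eqP => [->|_ _]; last by rewrite /= linvK eqxx.
by case: w => [|c w] //= /andP[/negPf -> _].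
Qed.

Lemma wmul_reduced u v : reduced v -> reduced (wmul u v).
Proof. by move=> rv; elim: u => //= a u; exact: push_reduced. Qed.

Lemma winv_reduced w : reduced w -> reduced (winv w).
Proof.
rewrite /reduced /winv rev_sorted sorted_map => rw.
rewrite (eq_sorted (e' := [rel a b | b != linv a])) // => a b /=.
by rewrite linvK eq_sym.
Qed.

Lemma wmul_push a u v : reduced v -> wmul (push a u) v = push a (wmul u v).
Proof.
move=> rv; case: u => [|b u] //=; case: eqP => [->|//].
by have /= := pushK (linv a) (wmul_reduced u rv); rewrite linvK => ->.
Qed.

Lemma wmulA u v w : reduced w -> wmul u (wmul v w) = wmul (wmul u v) w.
Proof. by move=> rw; elim: u => //= a u ->; rewrite wmul_push. Qed.

Lemma wmulw0 u : reduced u -> wmul u [::] = u.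
Proof.
elim: u => //= a u IHu rau; rewrite IHu; last exact: path_sorted rau.
by case: u rau {IHu} => //= b u /andP[/negPf ->].
Qed.

Lemma wmulKw u v : reduced v -> wmul (winv u) (wmul u v) = v.
Proof.
move=> rv; elim: u => //= a u IHu.
rewrite /winv /= rev_cons /wmul foldr_rcons /= pushK ?IHu //.
exact: wmul_reduced.
Qed.

Lemma winvK : involutive winv.
Proof.
move=> w; rewrite /winv map_rev revK -map_comp map_id_in // => a _ /=.
exact: linvK.
Qed.

Definition fg_one : free_group := @FreeWord [::] isT.
Definition fg_mul (u v : free_group) : free_group :=
  FreeWord (wmul_reduced u (valP v)).
Definition fg_inv (u : free_group) : free_group :=
  FreeWord (winv_reduced (valP u)).

Lemma fg_mulA : associative fg_mul.
Proof. by move=> u v w; apply: val_inj; apply: wmulA; exact: valP w. Qed.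
Lemma fg_mul1 : left_id fg_one fg_mul.
Proof. by move=> u; apply: val_inj. Qed.
Lemma fg_mulr1 : right_id fg_one fg_mul.
Proof. by move=> u; apply: val_inj; apply: wmulw0; exact: valP u. Qed.
Lemma fg_mulV : left_inverse fg_one fg_inv fg_mul.
Proof.
move=> u; apply: val_inj; rewrite /= -[X in wmul _ X]wmulw0; last exact: valP u.
exact: wmulKw.
Qed.
Lemma fg_mulrV : right_inverse fg_one fg_inv fg_mul.
Proof.
move=> u; rewrite -[X in fg_mul X _](_ : fg_inv (fg_inv u) = u) ?fg_mulV //.
by apply: val_inj; rewrite /= winvK.
Qed.

HB.instance Definition _ :=
  isGroup.Build free_group fg_mulA fg_mul1 fg_mulr1 fg_mulV fg_mulrV.

End FreeGroup.

Notation F2 := (free_group 'I_2).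

Section Span.
Variables (K : fieldType) (V : lmodType K).
Local Open Scope classical_set_scope.

(* The smallest linear subspace containing A. *)
Definition span (A : set V) : {pred V} := fun x =>
  `[< forall W : {pred V}, submod_closed W -> {subset A <= W} -> x \in W >].

Lemma span_submod_closed (A : set V) : submod_closed (span A).
Proof.
split=> [|a x y /asboolP xA /asboolP yA]; apply/asboolP => W sW AW.
  by case: sW.
by case: (sW) => _; apply; [exact: xA | exact: yA].
Qed.

HB.instance Definition _ (A : set V) :=
  GRing.isSubmodClosed.Build K V (span A) (span_submod_closed A).

Lemma mem_span (A : set V) x : A x -> x \in span A.
Proof. by move=> Ax; apply/asboolP => W _; apply; rewrite inE. Qed.

End Span.

(* The quotient of V by the subspace generated by A. The library makes        *)
(* [Quotient.quot] an abelian group only; the scalar action is added here.    *)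
Section QuotientSpace.
Variables (K : fieldType) (V : lmodType K) (A : set V).

Definition quot_space := Quotient.quot (span A).

HB.instance Definition _ := GRing.Zmodule.on quot_space.

Definition qproj (x : V) : quot_space := \pi_(Quotient.quot (span A)) x.

Lemma qproj_eq x y : (qproj x == qproj y) = (x - y \in span A).
Proof. by rewrite Quotient.idealrBE. Qed.

Lemma qproj_repr (x : quot_space) : qproj (repr x) = x.
Proof. exact: reprK. Qed.

Lemma qprojD x y : qproj (x + y) = qproj x + qproj y.
Proof. exact: (raddfD \pi_(Quotient.quot (span A))). Qed.

Definition qscale (a : K) (x : quot_space) : quot_space :=
  qproj (a *: repr x).

Lemma qscale_proj a x : qscale a (qproj x) = qproj (a *: x).
Proof.
apply/eqP; rewrite qproj_eq -scalerBr rpredZ //.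
by rewrite -qproj_eq qproj_repr.
Qed.

Lemma qscaleA a b x : qscale a (qscale b x) = qscale (a * b) x.
Proof. by rewrite -[x]qproj_repr !qscale_proj scalerA. Qed.
Lemma qscale1 : left_id 1 qscale.
Proof. by move=> x; rewrite -[x]qproj_repr qscale_proj scale1r. Qed.
Lemma qscaleDr : right_distributive qscale +%R.
Proof.
move=> a x y; rewrite -[x]qproj_repr -[y]qproj_repr.
by rewrite -qprojD !qscale_proj scalerDr qprojD.
Qed.
Lemma qscaleDl x : {morph qscale^~ x : a b / a + b}.
Proof. by move=> a b; rewrite -[x]qproj_repr !qscale_proj scalerDl qprojD. Qed.

HB.instance Definition _ := GRing.Zmodule_isLmodule.Build K quot_space
  qscaleA qscale1 qscaleDr qscaleDl.

Lemma qproj_linear : linear qproj.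
Proof. by move=> a x y; rewrite qprojD -qscale_proj. Qed.

HB.instance Definition _ := GRing.isLinear.Build K V quot_space _ qproj
  qproj_linear.

End QuotientSpace.

Definition lin_indep (K : fieldType) (V : lmodType K) n (v : 'I_n -> V) :=
  forall c : 'I_n -> K, \sum_i c i *: v i = 0 -> forall i, c i = 0.

Definition infinite_dimensional (K : fieldType) (V : lmodType K) :=
  forall n, exists v : 'I_n -> V, lin_indep v.

(* Norms take their values in the scalar field K, which below is either R or  *)
(* R[i]. In R[i], 0 <= z and 0 < z entail that z is real, so bounds and       *)
(* positive constants in K are real numbers in both cases.                    *)
Definition uniformly_convex (K : numFieldType) (E : normedModType K) :=
  forall eps : K, 0 < eps -> exists2 delta : K, 0 < delta &
    forall x y : E, `|x| <= 1 -> `|y| <= 1 -> eps <= `|x - y| ->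
      `|2^-1 *: (x + y)| <= 1 - delta.

(* O(E) *)
Record isometric_iso (K : numFieldType) (E : normedModType K) := IsometricIso {
  iso_fun :> {linear E -> E};
  iso_norm : forall x, `|iso_fun x| = `|x|;
  iso_bij : bijective iso_fun }.

Record unitary_rep (G : groupType) (K : numFieldType) (E : normedModType K) :=
  UnitaryRep {
    rep_fun :> G -> isometric_iso E;
    rep_mul : forall (g h : G) x, rep_fun (g * h)%g x = rep_fun g (rep_fun h x) }.

Section QuasiCocycles.
Variables (G : groupType) (K : numFieldType) (E : normedModType K).
Variable rho : unitary_rep G E.
Implicit Type F : G -> E.

Definition is_bounded F := exists M : K, forall g, `|F g| <= M.

Definition is_cocycle F := forall g h : G, F (g * h)%g = F g + rho g (F h).

Definition is_quasicocycle F := exists M : K, forall g h : G,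
  `|F (g * h)%g - F g - rho g (F h)| <= M.

Definition quasicocycles : {pred G -> E} := fun F => `[< is_quasicocycle F >].

Lemma quasicocycles_submod_closed : submod_closed quasicocycles.
Proof.
split.
  apply/asboolP; exists 0 => g h.
  rewrite -[leLHS]/(`|0 - 0 - rho g 0|).
  by rewrite linear0 !subr0 normr0.
move=> a F1 F2 /asboolP[M1 FM1] /asboolP[M2 FM2].
apply/asboolP; exists (`|a| * M1 + M2) => g h.
pose d F := F (g * h)%g - F g - rho g (F h).
rewrite -[leLHS]/(`|a *: F1 (g * h)%g + F2 (g * h)%g - (a *: F1 g + F2 g) -
  rho g (a *: F1 h + F2 h)|).
have -> : a *: F1 (g * h)%g + F2 (g * h)%g - (a *: F1 g + F2 g) -
    rho g (a *: F1 h + F2 h) = a *: d F1 + d F2.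
  rewrite (linearP (rho g)) /d !scalerBr !opprD.
  by rewrite [in LHS](addrACA (a *: _)) [LHS]addrACA.
apply: le_trans (ler_normD _ _) _; apply: lerD; last exact: FM2.
by rewrite normrZ; apply: ler_wpM2l => //; exact: FM1.
Qed.

HB.instance Definition _ :=
  GRing.isSubmodClosed.Build K (G -> E) quasicocycles quasicocycles_submod_closed.

Record QC := MkQC { qc_fun :> G -> E; _ : qc_fun \in quasicocycles }.

HB.instance Definition _ := [isSub for qc_fun].
HB.instance Definition _ := [Choice of QC by <:].
HB.instance Definition _ := [SubChoice_isSubLmodule of QC by <:].

(* Bounded functions and cocycles are quasi-cocycles, so that nothing is lost *)
(* in [QCtilde] by taking only those which are elements of [QC].             *)
Lemma bounded_quasicocycle F : is_bounded F -> F \in quasicocycles.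
Proof.
case=> M FM; apply/asboolP; exists (M + M + M) => g h.
apply: le_trans (ler_normB _ _) _; rewrite iso_norm lerD //.
by apply: le_trans (ler_normB _ _) _; rewrite lerD.
Qed.

Lemma cocycle_quasicocycle F : is_cocycle F -> F \in quasicocycles.
Proof.
move=> FC; apply/asboolP; exists 0 => g h.
by rewrite FC addrAC addrK subrr normr0.
Qed.

Definition QCtilde : lmodType K :=
  quot_space [set F : QC | is_bounded F \/ is_cocycle F]%classic.

End QuasiCocycles.

(* Main.v *)
(* For e in E and w_i = b^(i+1) a, let F_i be the equivariant Brooks          *)
(* quasi-cocycle: F_i(g) sums x w_i e over the factorizations g = x w_i y,    *)
(* minus the corresponding sum for the inverse word. Suppose that             *)
(* D = sum_i c_i F_i - C is bounded for a cocycle C. On products of the       *)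
(* blocks B_m = b^m a, passing from g to g B_m moves g^-1 D(g) by the         *)
(* isometry T_m z = B_m^-1 (z - C(B_m)) + (c_0 + ... + c_(m-1)) e. All T_m    *)
(* thus preserve a common bounded set, so by uniform convexity they have      *)
(* common almost fixed points z. For m >= n the translation parts of T_m and  *)
(* T_(m+1) agree, which makes z almost fixed by z |-> b^-1 (z - C(b)); then   *)
(* T_(j+1) z - T_j z is close to c_j e for every j, and so c_j e = 0.         *)

Require Import Defs.
From mathcomp Require Import all_boot all_order all_algebra.
From mathcomp Require Import all_classical all_reals all_analysis.
From mathcomp Require Import complex.

Import Order.TTheory GRing.Theory Num.Theory.
Import numFieldNormedType.Exports.

Local Open Scope ring_scope.

(** The F_i are quasi-cocycles because only occurrences meeting a seam are miscounted and the
    cancelled segment of a product contributes opposite terms ([brooks_quasicocycle]). On positive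
    words made of blocks nothing straddles a seam, so the counts are exact ([count_block_cat],
    [count_block]); this is why the T_m preserve a bounded set. Uniform convexity enters through
    [almost_fixed_point], which gives one point that all T_m move little; [brooks_block_indep] reads
    off the coefficients there. By [span_bounded_cocycle], a relation in the quotient has exactly
    the form excluded there. *)

(** * Almost fixed points in uniformly convex spaces *)

Section AlmostFixedPoints.
Context {K : numFieldType} {E : normedModType K}.
Hypothesis K_arch : forall x : K, 0 <= x -> exists n : nat, x <= n%:R.
Hypothesis E_ucvx : uniformly_convex E.

(** Rescaling by 1/r turns the separation eps into eps/r, which is at least eps/r0; the modulus for
    eps/r0 therefore serves all radii up to r0. *)
Lemma uniformly_convex_ball (r0 eps : K) : 0 < r0 -> 0 < eps ->
  exists2 delta, 0 < delta & forall (r : K) (u v : E), 0 < r -> r <= r0 ->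
    `|u| <= r -> `|v| <= r -> eps <= `|u - v| ->
    `|2^-1 *: (u + v)| <= r * (1 - delta).
Proof.
move=> r0_gt0 eps_gt0; have [d d_gt0 dP] := E_ucvx _ (divr_gt0 eps_gt0 r0_gt0).
exists d => // r u v r_gt0 r_le ur vr uv.
have nZ x : `|r^-1 *: x| = `|x| / r :> K.
  by rewrite normrZ gtr0_norm ?invr_gt0 // mulrC.
have := dP (r^-1 *: u) (r^-1 *: v).
rewrite -scalerBr -scalerDr scalerA [2^-1 * _]mulrC -scalerA !nZ.
move=> dP'; rewrite [r * _]mulrC -ler_pdivrMr //; apply: dP'.
- by rewrite ler_pdivrMr ?mul1r.
- by rewrite ler_pdivrMr ?mul1r.
apply: le_trans (_ : eps / r <= _).
  by rewrite ler_pM2l // lef_pV2 ?posrE.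
by rewrite ler_pM2r ?invr_gt0.
Qed.

(* If some [T i] moves the centre [z] of a ball containing [S] by [eps], then *)
(* [S] lies in the balls of the same radius around [z] and [T' i z], hence in *)
(* a definitely smaller ball around their midpoint. *)
Lemma almost_fixed_point (I : Type) (T T' : I -> E -> E) (S : E -> Prop) :
  (forall i x y, `|T i x - y| = `|x - T' i y|) ->
  (exists x, S x) -> (exists M : K, forall x, S x -> `|x| <= M) ->
  (forall i x, S x -> S (T i x)) ->
  forall eps : K, 0 < eps -> exists z, forall i, `|T i z - z| < eps.
Proof.
move=> TT' [x0 Sx0] [M SM] ST eps eps_gt0; apply: contrapT => noz.
have mv z : exists i, eps <= `|T i z - z|.
  apply: contrapT => nz; apply: noz; exists z => i.
  rewrite real_ltNge ?normr_real ?gtr0_real //.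
  by apply/negP => ?; apply: nz; exists i.
have M_ge0 : 0 <= M := le_trans (normr_ge0 _) (SM _ Sx0).
have M1_gt0 : 0 < M + 1 by rewrite ltr_wpDl.
have [d d_gt0 dP] := uniformly_convex_ball (M + 1) eps M1_gt0 eps_gt0.
pose s := eps / 2 * d; have s_gt0 : 0 < s by rewrite mulr_gt0 ?divr_gt0.
have ball n : exists z, forall x, S x -> `|x - z| <= M + 1 - n%:R * s.
  elim: n => [|n [z zP]].
    by exists 0 => x Sx; rewrite mul0r !subr0 (le_trans (SM _ Sx)) ?lerDl.
  have [i iz] := mv z; set r := M + 1 - n%:R * s in zP.
  have zP' x (Sx : S x) : `|x - T' i z| <= r by rewrite -TT'; exact: zP (ST i _ Sx).
  have zz x : eps <= `|(x - z) - (x - T' i z)|.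
    by rewrite opprB addrC subrKA distrC -TT'.
  (* A point of [S] is within r of two centres at least eps apart. So each step shrinks the radius
     by r * d, at least [s]. *)
  have r_ge : eps / 2 <= r.
    rewrite ler_pdivrMr // mulr_natr mulr2n (le_trans (zz x0)) //.
    by rewrite (le_trans (ler_normB _ _)) ?lerD ?zP ?zP'.
  have r_gt0 : 0 < r by rewrite (lt_le_trans _ r_ge) ?divr_gt0.
  exists (2^-1 *: (z + T' i z)) => x Sx.
  have -> : x - 2^-1 *: (z + T' i z) = 2^-1 *: ((x - z) + (x - T' i z)).
    rewrite [in RHS]addrACA -opprD scalerBr; congr (_ - _).
    by rewrite -[x in RHS]scale1r -scalerDl scalerA mulVf ?scale1r ?pnatr_eq0.
  apply: le_trans (dP r _ _ r_gt0 _ (zP _ Sx) (zP' _ Sx) _) _.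
  - by rewrite lerBlDr lerDl mulr_ge0 ?ler0n ?ltW.
  - exact: zz.
  rewrite mulrBr mulr1 -[n.+1%:R]natr1 [_ * s]mulrDl mul1r opprD addrA lerD2l lerN2.
  by rewrite ler_pM2r.
(* For this [n] the radius is negative, although [S] is inhabited. *)
have [n nP] : exists n : nat, (M + 1) / s + 1 <= n%:R.
  by apply: K_arch; rewrite addr_ge0 ?divr_ge0 ?ltW.
have [z /(_ _ Sx0)/(le_trans (normr_ge0 _))] := ball n.
apply/negP; rewrite -real_ltNge ?real0 //; last first.
  by rewrite rpredB ?rpredM ?realn ?gtr0_real.
rewrite subr_lt0 -ltr_pdivrMr //.
by apply: lt_le_trans nP; rewrite ltrDl.
Qed.

End AlmostFixedPoints.

(** * Unitary representations as group actions *)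

Section IsometricActions.
Context {G : groupType} {K : numFieldType} {E : normedModType K}.
Variable rho : unitary_rep G E.

Lemma rep_inj g : injective (rho g).
Proof. exact: bij_inj (iso_bij (rho g)). Qed.

Lemma rep1 x : rho 1%g x = x.
Proof. by apply: (rep_inj 1%g); rewrite -rep_mul mulg1. Qed.

Lemma repK g : cancel (rho g) (rho g^-1%g).
Proof. by move=> x; rewrite -rep_mul mulVg rep1. Qed.

Lemma repVK g : cancel (rho g^-1%g) (rho g).
Proof. by move=> x; rewrite -rep_mul mulgV rep1. Qed.

End IsometricActions.

(** * Words and cancellation in the free group *)

Section Words.
Context {X : choiceType}.
Implicit Types (u v w l : seq (letter X)).

Definition word_val l : free_group X :=
  FreeWord (wmul_reduced l (isT : reduced [::])).

Lemma word_val_nil : word_val [::] = 1%g.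
Proof. exact: val_inj. Qed.

Lemma word_val_fg (g : free_group X) : word_val (fg_word g) = g.
Proof. by apply: val_inj; rewrite /= wmulw0 //; case: g. Qed.

Lemma word_val_cat u v : word_val (u ++ v) = (word_val u * word_val v)%g.
Proof.
apply: val_inj; rewrite /= -wmulA; last exact: wmul_reduced.
by rewrite /wmul foldr_cat.
Qed.

Lemma word_val_cons a l : word_val (a :: l) = (word_val [:: a] * word_val l)%g.
Proof. by rewrite -word_val_cat. Qed.

Lemma winv_cons a l : winv (a :: l) = rcons (winv l) (linv a).
Proof. by rewrite /winv /= rev_cons. Qed.

Lemma winv_cat u v : winv (u ++ v) = winv v ++ winv u.
Proof. by rewrite /winv map_cat rev_cat. Qed.

Lemma word_val_winv l : word_val (winv l) = (word_val l)^-1%g.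
Proof.
apply/esym/mulg1_eq; elim: l => [|a l IHl]; first by rewrite word_val_nil mulg1.
rewrite winv_cons -cats1 word_val_cat word_val_cons -mulgA [(word_val l * _)%g]mulgA.
rewrite IHl mul1g -word_val_cat; apply: val_inj => /=.
by rewrite eqxx.
Qed.

(** Once cancellation stops it stops for good: a letter of [u] preceding a nonempty [p] cannot
    cancel, since [u] is reduced. This reduces estimates on products to estimates on
    concatenations. *)
Lemma reduced_mulP u v : reduced u -> reduced v -> exists p c q,
  [/\ u = p ++ c, v = winv c ++ q & wmul u v = p ++ q].
Proof.
elim: u => [|x u IHu] ru rv; first by exists [::], [::], v.
have [p [c [q [uE vE uvE]]]] := IHu (path_sorted ru) rv.
rewrite /= uvE; case: p => [|y p] in uE uvE *.
  case: q => [|y q] in vE uvE *.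
    by exists [:: x], c, [::]; rewrite uE.
  rewrite /=; case: eqP => [yx|_]; last by exists [:: x], c, (y :: q); rewrite uE.
  by exists [::], (x :: c), q; split; rewrite ?uE // winv_cons cat_rcons -yx.
exists [:: x, y & p], c, q; split=> //=; first by rewrite uE.
by case: eqP ru => // yx; rewrite uE /= yx /reduced /= eqxx.
Qed.

End Words.

(** * Brooks quasi-cocycles with coefficients in E *)

Section Counting.
Context {X : choiceType} {K : numFieldType} {E : normedModType K}.
Variable rho : unitary_rep (free_group X) E.
Implicit Types (u v w l : seq (letter X)) (e : E).

(** For nonempty [w], the sum of x e over all factorizations l = x w y, overlapping occurrences
    included. *)
Fixpoint count_word w e l : E :=
  if l is a :: l' then
    (if prefix w l then e else 0) + rho (word_val [:: a]) (count_word w e l')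
  else 0.

Lemma count_word_cons w e a l : count_word w e (a :: l) =
  (if prefix w (a :: l) then e else 0) + rho (word_val [:: a]) (count_word w e l).
Proof. by []. Qed.

(** The difference counts only the occurrences that straddle the seam, at most [size w] in number
    and each of norm |e|. *)
Lemma count_word_cat_bounded w e : exists M : K, forall u v,
  `|count_word w e (u ++ v) - count_word w e u
    - rho (word_val u) (count_word w e v)| <= M.
Proof.
exists (`|e| *+ size w) => u v.
(* The minimum makes the induction work: a position of [u] followed there by enough letters to hold
   [w] does not see [v]. *)
apply: le_trans (_ : `|e| *+ minn (size u) (size w) <= _); last first.
  by apply: (ler_wpMn2l (normr_ge0 e)); rewrite geq_minr.
elim: u => [|a u IHu]; first by rewrite word_val_nil rep1 subr0 subrr normr0 min0n.
rewrite [word_val _]word_val_cons rep_mul /=.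
set h1 := if prefix w (a :: u ++ v) then e else 0.
set h2 := if prefix w (a :: u) then e else 0.
set D := rho _.
have -> : h1 + D (count_word w e (u ++ v)) - (h2 + D (count_word w e u))
     - D (rho (word_val u) (count_word w e v)) = (h1 - h2) +
   D (count_word w e (u ++ v) - count_word w e u
      - rho (word_val u) (count_word w e v)).
  by rewrite !linearB /= opprD addrACA -!addrA.
apply: le_trans (ler_normD _ _) _; rewrite iso_norm.
have [wu|uw] := leqP (size w) (size u).+1.
  rewrite /h1 /h2 !prefixE -cat_cons takel_cat // subrr normr0 add0r.
  apply: le_trans IHu _; apply: (ler_wpMn2l (normr_ge0 e)).
  exact: geq_minr.
rewrite mulrS lerD //; last first.
  by rewrite (minn_idPl _) // in IHu; exact: ltnW (ltnW uw).
by rewrite /h1 /h2; do 2!case: ifP => _;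
   rewrite ?subrr ?subr0 ?sub0r ?normrN ?normr0 ?normr_ge0.
Qed.

(* The correction makes this antisymmetric: its value at [winv l] is minus    *)
(* the inverse of [l] applied to its value at [l]. *)
Definition brooks w e l : E :=
  count_word w e l - rho (word_val l) (count_word w e (winv l)).

Lemma brooks_winv w e l :
  brooks w e (winv l) = - rho (word_val l)^-1%g (brooks w e l).
Proof. by rewrite /brooks winvK word_val_winv linearB /= repK opprB. Qed.

Lemma brooks_cat_bounded w e : exists M : K, forall u v,
  `|brooks w e (u ++ v) - brooks w e u - rho (word_val u) (brooks w e v)| <= M.
Proof.
have [M MP] := count_word_cat_bounded w e; exists (M + M) => u v.
rewrite /brooks winv_cat word_val_cat.
set c := count_word w e; set g := word_val u; set h := word_val v.
have -> : c (u ++ v) - rho (g * h)%g (c (winv v ++ winv u))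
    - (c u - rho g (c (winv u))) - rho g (c v - rho h (c (winv v))) =
  (c (u ++ v) - c u - rho g (c v))
  - rho (g * h)%g (c (winv v ++ winv u) - c (winv v)
                   - rho (word_val (winv v)) (c (winv u))).
  rewrite word_val_winv !linearB /= !rep_mul repVK !opprK !addrA.
  by rewrite [LHS](ACl (1*3*5*2*6*4)).
by apply: le_trans (ler_normB _ _) _; rewrite iso_norm lerD ?MP.
Qed.

(** With g = p c, h = c^-1 q and gh = p q, the defect is made of three concatenation defects; the
    terms in c and c^-1 cancel by [brooks_winv]. *)
Lemma brooks_quasicocycle w e :
  (fun g : free_group X => brooks w e (fg_word g)) \in quasicocycles rho.
Proof.
have [M MP] := brooks_cat_bounded w e.
apply/asboolP; exists (M + M + M) => g h; cbv beta.
have [p [c [q [gE hE ghE]]]] := reduced_mulP _ _ (valP g) (valP h).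
rewrite [fg_word (g * h)%g]ghE [fg_word g]gE [fg_word h]hE.
rewrite -[g in rho g]word_val_fg [fg_word g]gE word_val_cat.
set B := brooks w e; set P := rho (word_val p); set C := word_val c.
have -> : B (p ++ q) - B (p ++ c) - rho (word_val p * C)%g (B (winv c ++ q)) =
  (B (p ++ q) - B p - P (B q)) - (B (p ++ c) - B p - P (B c))
  - rho (word_val p * C)%g
     (B (winv c ++ q) - B (winv c) - rho (word_val (winv c)) (B q)).
  have -> : B (winv c) = - rho C^-1%g (B c) by exact: brooks_winv.
  have PC y : rho (word_val p * C)%g (rho C^-1%g y) = P y.
    by rewrite rep_mul repVK.
  have PCD x y z : rho (word_val p * C)%g (x + y - z) =
      rho (word_val p * C)%g x + rho (word_val p * C)%g y - rho (word_val p * C)%g z.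
    by rewrite linearB linearD.
  clearbody B; rewrite word_val_winv -/C opprK PCD !PC.
  rewrite !opprB !opprD !addrA [RHS](ACl (1*6*8*(2*5)*(3*7)*(4*9))) /=.
  by rewrite !addNr ?subrr !addr0.
apply: le_trans (ler_normB _ _) _; rewrite iso_norm lerD ?MP //.
by apply: le_trans (ler_normB _ _) _; rewrite lerD ?MP.
Qed.

End Counting.

(** * Functions at bounded distance from a cocycle *)

Section CocyclesModBounded.
Context {G : groupType} {K : numFieldType} {E : normedModType K}.
Variable rho : unitary_rep G E.

(** The functions at bounded distance from a cocycle form a subspace containing all the
    generators. *)
Lemma span_bounded_cocycle (F : QC rho) :
  F \in Defs.span [set F : QC rho | is_bounded F \/ is_cocycle rho F]%classic ->
  exists2 C : G -> E, is_cocycle rho C & is_bounded (fun g => F g - C g).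
Proof.
pose W : {pred QC rho} := fun F =>
  `[< exists2 C : G -> E, is_cocycle rho C & is_bounded (fun g => F g - C g) >].
move=> /asboolP FW; apply/asboolP; apply: (FW W) => [|{F FW} F].
- split; first apply/asboolP.
    exists (fun=> 0); first by move=> g h; rewrite linear0 addr0.
    by exists 0 => g; rewrite subr0 normr0.
  move=> c F1 F2 /asboolP[C1 C1c [M1 M1P]] /asboolP[C2 C2c [M2 M2P]].
  apply/asboolP; exists (fun g => c *: C1 g + C2 g).
    by move=> g h; rewrite C1c C2c linearP scalerDr addrACA.
  exists (`|c| * M1 + M2) => g.
  rewrite -[leLHS]/(`|c *: F1 g + F2 g - (c *: C1 g + C2 g)|).
  rewrite opprD addrACA -scalerBr (le_trans (ler_normD _ _)) // normrZ.
  by rewrite lerD ?ler_wpM2l.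
rewrite inE => -[Fb|Fc]; apply/asboolP.
  exists (fun=> 0); first by move=> g h; rewrite linear0 addr0.
  by have [M MP] := Fb; exists M => g; rewrite subr0.
by exists F => //; exists 0 => g; rewrite subrr normr0.
Qed.

End CocyclesModBounded.

(** * Exact counts of blocks in positive words *)

Section PositiveWords.
Context {X : choiceType} {K : numFieldType} {E : normedModType K}.
Variables (rho : unitary_rep (free_group X) E) (x y : X).
Hypothesis xy : x != y.
Implicit Types (w l : seq (letter X)) (e : E).

Definition positive l := all (fun s => ~~ s.2) l.

Lemma positive_reduced l : positive l -> reduced l.
Proof.
case: l => [|a l] //; elim: l a => // b l IHl a /and3P[a0 b0 l0].
rewrite /reduced /=; apply/andP; split; last by apply: IHl; rewrite /positive /= b0.
by apply: contraNneq b0 => ->; rewrite /= a0.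
Qed.

(** The inverse of a positive word has only inverse letters, so [w] does not occur in it. *)
Lemma brooks_positive w e l : w != [::] -> positive w -> positive l ->
  brooks rho w e l = count_word rho w e l.
Proof.
move=> w0 wpos lpos; rewrite /brooks (_ : count_word _ _ _ (winv l) = 0).
  by rewrite linear0 subr0.
have : all snd (winv l) by rewrite all_rev all_map.
case: w w0 wpos => // a w _ /= /andP[a0 _].
elim: (winv l) => //= b k IHk /andP[b1 /IHk ->].
by rewrite linear0 addr0; case: eqP a0 => // ->; rewrite b1.
Qed.

Let a : letter X := (y, false).
Let b : letter X := (x, false).

Definition block m : seq (letter X) := rcons (nseq m b) a.

Lemma block_positive m : positive (block m).
Proof. by rewrite /positive all_rcons all_nseq orbT. Qed.

Let ab : (a == b) = false.
Proof. by apply: contraNF xy => /eqP[->]. Qed.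

Let ba : (b == a) = false.
Proof. by rewrite eq_sym ab. Qed.

Lemma prefix_block i m : prefix (block i) (block m) = (i == m).
Proof.
elim: i m => [|i IHi] [|m] /=; rewrite ?eqxx ?ab ?ba //=.
exact: IHi.
Qed.

(** A block contains [a] only as its last letter, so a block starting inside [l] cannot run past the
    final [a] of [l]. *)
Lemma prefix_block_cat i l l' : l != [::] -> last a l = a ->
  prefix (block i) (l ++ l') = prefix (block i) l.
Proof.
elim: i l => [|i IHi] [|s l] //= _; first by rewrite !prefix0s.
case: eqP => //= <-; case: l => [/eqP|t l la]; first by rewrite ba.
exact: IHi.
Qed.

Lemma count_block_cat i e l l' : last a l = a ->
  count_word rho (block i) e (l ++ l') =
  count_word rho (block i) e l
    + rho (word_val l) (count_word rho (block i) e l').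
Proof.
elim: l => [|s l IHl] la; first by rewrite word_val_nil rep1 add0r.
have la' : last a l = a by case: l la {IHl}.
rewrite word_val_cons rep_mul cat_cons !count_word_cons IHl // -cat_cons.
by rewrite prefix_block_cat // linearD addrA.
Qed.

(** For i <= m the only occurrence follows b^(m-i), and b^(m-i) b^i a = b^m a: the contribution does
    not depend on i. *)
Lemma count_block i m e :
  count_word rho (block i) (rho (word_val (block i)) e) (block m) =
  if (i <= m)%N then rho (word_val (block m)) e else 0.
Proof.
set u := rho _ e; elim: m => [|m IHm].
  have -> : count_word rho (block i) u (block 0) =
      (if prefix (block i) (block 0) then u else 0) + rho (word_val [:: a]) 0.
    by [].
  by rewrite prefix_block linear0 addr0 leqn0 /u; case: eqP => // ->.
have -> : count_word rho (block i) u (block m.+1) =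
    (if prefix (block i) (block m.+1) then u else 0)
      + rho (word_val [:: b]) (count_word rho (block i) u (block m)).
  by [].
rewrite prefix_block IHm /u {IHm u}.
have [->|im] := eqVneq i m.+1; first by rewrite ltnn linear0 addr0 leqnn.
rewrite [in RHS]leq_eqVlt (negPf im) ltnS add0r.
by case: ifP => _; rewrite ?linear0 // -rep_mul -word_val_cons.
Qed.

End PositiveWords.

(** * Independence modulo bounded functions and cocycles *)

Section Independence.
Context {X : choiceType} {K : numFieldType} {E : normedModType K}.
Variables (rho : unitary_rep (free_group X) E) (x y : X).
Hypothesis xy : x != y.
Hypothesis K_arch : forall x : K, 0 <= x -> exists n : nat, x <= n%:R.
Hypothesis E_ucvx : uniformly_convex E.
Variable e : E.
Hypothesis e_neq0 : e != 0.

Let a : letter X := (y, false).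
Let b : letter X := (x, false).
Let B m := word_val (block x y m).
(** The shift to [i.+1] makes block m see exactly the F_i with i < m, so every coefficient, c_0
    included, is a difference of consecutive partial sums. *)
Let F (i : nat) l := brooks rho (block x y i.+1) (rho (B i.+1) e) l.

Lemma brooks_block_indep n (c : 'I_n -> K) (C : free_group X -> E) :
  is_cocycle rho C ->
  is_bounded (fun g => \sum_i c i *: F i (fg_word g) - C g) ->
  forall i, c i = 0.
Proof.
move=> Cc [M MP] j; apply: contrapT => /eqP cj_neq0.
pose s m := \sum_(i < n | (i < m)%N) c i.
pose Phi l := \sum_i c i *: F i l.
have Phi_cat l m : positive l -> last a l = a ->
    Phi (l ++ block x y m) = Phi l + rho (word_val l) (rho (B m) (s m *: e)).
  move=> lpos la; rewrite /s scaler_suml !linear_sum /= big_mkcond -big_split /=.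
  apply: eq_bigr => i _.
  have lbpos : positive (l ++ block x y m).
    by rewrite /positive all_cat [all _ l]lpos [all _ _]block_positive.
  rewrite /F !brooks_positive ?block_positive // count_block_cat //.
  rewrite (count_block rho x y xy) scalerDr; congr (_ + _).
  by case: ifP => _; rewrite ?linear0 ?scaler0 // !linearZ.
(* [U h] inverts z |-> h z + C(h), the affine isometric action given by [C]. *)
pose U h z := rho h^-1%g (z - C h).
have U_mul g h z : U (g * h)%g z = U h (U g z).
  by rewrite /U Cc invgM rep_mul opprD addrA linearB /= repK.
have U_iso h z t : `|U h z - U h t| = `|z - t|.
  by rewrite /U -linearB iso_norm opprB addrA subrK.
pose T m z := U (B m) z + s m *: e.
pose T' m z := rho (B m) (z - s m *: e) + C (B m).
(* The default [a] of [last] admits the empty word, which shows that [S] is inhabited. *)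
pose S z := exists l, [/\ positive l, last a l = a &
  z = rho (word_val l)^-1%g (Phi l - C (word_val l))].
have [|||||z zP] := almost_fixed_point K_arch E_ucvx nat T T' S _ _ _ _
    (* A quarter, since c_j e will be a difference of two vectors, each of norm below 2 eps. *)
    (`|c j *: e| / 4).
- move=> m z t; rewrite /T /T' /U -(iso_norm (rho (B m))).
  rewrite linearB linearD /= repVK [rho _ (t - _)]linearB opprD opprB -!addrA.
  by congr (`|_ + _|); rewrite [LHS]addrC -addrA.
- by exists (rho (word_val [::])^-1%g (Phi [::] - C (word_val [::]))), [::].
- exists M => _ [l [lpos la ->]]; rewrite iso_norm.
  have := MP (word_val l); rewrite [fg_word _]wmulw0 //; exact: positive_reduced.
- move=> m _ [l [lpos la ->]]; exists (l ++ block x y m); split.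
  + by rewrite /positive all_cat [all _ l]lpos [all _ _]block_positive.
  + by rewrite last_cat last_rcons.
  rewrite Phi_cat // word_val_cat Cc invgM rep_mul /T /U.
  set u := Phi l; set v := C (word_val l); set t := rho (B m) _.
  rewrite [in RHS]opprD [in RHS]addrACA -[rho _ t - _]linearB.
  rewrite [rho _ (u - v + _)]linearD /= repK [t - _]addrC addrA.
  by rewrite [in RHS]linearD /= repK.
- by rewrite divr_gt0 // normr_gt0 scaler_eq0 negb_or cj_neq0.
set eps := `|c j *: e| / 4 in zP.
pose eta := `|U (word_val [:: b]) z - z|.
(* As B_(m+1) = b B_m and [U (B m)] is an isometry, this displacement is independent of m; it is
   bounded at m = n, where [s] has become constant, and used at m = j. *)
have U_block m : `|U (B m.+1) z - U (B m) z| = eta.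
  by rewrite /B -[block x y m.+1]/(b :: block x y m) word_val_cons U_mul U_iso.
have T_step m : `|T m.+1 z - T m z| < eps + eps.
  rewrite -(subrKA z) (le_lt_trans (ler_normD _ _)) // ltrD ?zP //.
  by rewrite distrC zP.
have eta_lt : eta < eps + eps.
  rewrite -(U_block n); apply: le_lt_trans (T_step n).
  rewrite /T (_ : s n.+1 = s n) ?opprD ?addrA ?[_ + _ - U _ _]addrAC ?addrK //.
  by apply: eq_bigl => i; rewrite ltnS ltnW // ltn_ord.
have sj : s j.+1 - s j = c j.
  rewrite /s (bigD1 j) ?ltnSn //= -addrA [X in _ + X](_ : _ = 0) ?addr0 //.
  apply/eqP; rewrite subr_eq0; apply/eqP/eq_bigl => i.
  by rewrite ltnS [(i < j)%N]ltn_neqAle andbC.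
have cje : c j *: e = (T j.+1 z - T j z) - (U (B j.+1) z - U (B j) z).
  by rewrite /T opprD addrACA [X in _ = X]addrAC subrr add0r -scalerBl sj.
have : `|c j *: e| < (eps + eps) + (eps + eps).
  rewrite {1}cje (le_lt_trans (ler_normB _ _)) // ltrD // ?U_block //.
rewrite -!mulr2n -mulrnA -mulr_natr divfK ?ltxx //.
Qed.

Lemma QCtilde_free_group_infinite_dimensional :
  infinite_dimensional (QCtilde rho).
Proof.
move=> n; pose f (i : 'I_n) : QC rho :=
  MkQC (brooks_quasicocycle rho (block x y i.+1) (rho (B i.+1) e)).
exists (fun i => qproj _ (f i)) => c c0.
have : \sum_i c i *: f i \in
    Defs.span [set F : QC rho | is_bounded F \/ is_cocycle rho F]%classic.
  rewrite -[X in X \in _]subr0 -qproj_eq linear_sum linear0.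
  by rewrite -[X in _ == X]c0; apply/eqP/eq_bigr => i _; rewrite linearZ.
move=> /span_bounded_cocycle[C Cc CM]; apply: (brooks_block_indep _ _ _ Cc).
have [M MP] := CM; exists M => g; apply: le_trans (MP g).
rewrite (big_morph (fun F : QC rho => F g) (id1 := 0) (op1 := +%R)) //.
Qed.

End Independence.

(** * Archimedean scalars and the conclusion *)

Lemma realType_archimedean (R : realType) (x : R) :
  0 <= x -> exists n : nat, x <= n%:R.
Proof. by move=> x_ge0; exists (Num.bound x); exact/ltW/archi_boundP. Qed.

Lemma complex_archimedean (R : realType) (x : R[i]) :
  0 <= x -> exists n : nat, x <= n%:R.
Proof.
rewrite lecE => /andP[/eqP x0 /realType_archimedean[n xn]].
exists n; rewrite -(rmorph_nat (real_complex R)) lecE x0 eqxx; exact: xn.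
Qed.

Theorem theorem1p1 (R : realType) :
  (forall (E : completeNormedModType R) (rho : unitary_rep F2 E),
     uniformly_convex E -> (exists x : E, x != 0) ->
     infinite_dimensional (QCtilde rho)) /\
  (forall (E : completeNormedModType R[i]) (rho : unitary_rep F2 E),
     uniformly_convex E -> (exists x : E, x != 0) ->
     infinite_dimensional (QCtilde rho)).
Proof.
have neq01 : ord0 != ord_max :> 'I_2 by [].
split=> E rho E_ucvx [e e_neq0];
  apply: (QCtilde_free_group_infinite_dimensional rho _ _ neq01 _ E_ucvx _ e_neq0).
- exact: realType_archimedean.
- exact: complex_archimedean.
Qed.
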